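(* Let $\mathcal{H}_A\otimes\mathcal{H}_B$ be a finite-dimensional bipartite Hilbert space. The $S^{t}$-entropy entanglement $E_t$ is an entanglement measure, i.e. it satisfies: (E1) $E_t(\rho)\ge0$ for every state $\rho$, with $E_t(\rho)=0$ if and only if $\rho$ is separable; (E2) $E_t\big((U_A\otimes U_B)\rho(U_A\otimes U_B)^\dagger\big)=E_t(\rho)$ for all local unitaries $U_A,U_B$; (E3) for every LOCC operation mapping $\rho$ to the ensemble $\{p_j,\sigma_j\}$ (i.e. outcome $j$ occurs with probability $p_j$ leaving state $\sigma_j$), $\sum_jp_jE_t(\sigma_j)\le E_t(\rho)$; (E4) $E_t(\sum_ip_i\rho_i)\le\sum_ip_iE_t(\rho_i)$ for every probability distribution $\{p_i\}$ and states $\rho_i$.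
   Context: For a density operator $\rho$ on a finite-dimensional Hilbert space, the total entropy is $S^{t}(\rho)=-\mathrm{Tr}\big[\rho\log_2\rho+(\mathbb{1}-\rho)\log_2(\mathbb{1}-\rho)\big]=\sum_i g(\lambda_i)$, where $\lambda_i$ are the eigenvalues of $\rho$ and $g(x)=-x\log_2x-(1-x)\log_2(1-x)$ (convention $0\log_20=0$). The $S^{t}$-entropy entanglement of a pure state $|\Phi\rangle_{AB}$ on $\mathcal{H}_A\otimes\mathcal{H}_B$ with $\dim\mathcal{H}_A=d$ is $E_t(|\Phi\rangle_{AB})=\frac1r S^{t}(\varrho_A)$ where $\varrho_A=\mathrm{Tr}_B|\Phi\rangle\langle\Phi|$ and $r=d\log_2d-(d-1)\log_2(d-1)$ is a fixed normalization constant. For a mixed state, $E_t(\rho_{AB})=\inf\sum_ip_iE_t(|\Phi_i\rangle)$, the infimum over all decompositions $\rho_{AB}=\sum_ip_i|\Phi_i\rangle\langle\Phi_i|$ into pure states with $p_i\ge0$, $\sum_ip_i=1$. *)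

(* Defs.v *)
From HB Require Import structures.
From mathcomp Require Import all_boot all_order all_algebra.
From mathcomp Require Import complex mxtens.
From mathcomp Require Import classical_sets reals exp.

Set Implicit Arguments.
Unset Strict Implicit.
Unset Printing Implicit Defensive.

Import Order.TTheory GRing.Theory Num.Theory.
Local Open Scope ring_scope.
Local Open Scope sesquilinear_scope.
Local Open Scope classical_set_scope.
Local Open Scope complex_scope.

Section Entanglement.
Variable R : realType.
Local Notation C := (R[i]).

Definition xlog2 (x : R) : R := if x == 0 then 0 else x * ln x / ln 2.
Definition gbin (x : R) : R := - xlog2 x - xlog2 (1 - x).

(* the eigenvalues (with multiplicity) of a square matrix = roots of its
   characteristic polynomial (which splits over the closed field C) *)
Definition eigvals n (A : 'M[C]_n) : seq C :=
  sval (closed_field_poly_normal (char_poly A)).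

(* S^t(rho) = sum_i g(lambda_i)  (eigenvalues of a density operator are real;
   we take their real part) *)
Definition St n (A : 'M[C]_n) : R :=
  \sum_(z <- eigvals A) gbin (complex.Re z).

Definition hermitian n (A : 'M[C]_n) : Prop := A ^t* = A.
Definition psd n (A : 'M[C]_n) : Prop :=
  hermitian A /\ forall x : 'cV[C]_n, 0 <= (x ^t* *m A *m x) 0 0.
Definition is_state n (A : 'M[C]_n) : Prop := psd A /\ \tr A = 1.
Definition unit_vec n (v : 'cV[C]_n) : Prop := (v ^t* *m v) 0 0 = 1.
Definition proj n (v : 'cV[C]_n) : 'M[C]_n := v *m v ^t*.

Definition is_prob n (p : 'I_n -> R) : Prop :=
  (forall i, 0 <= p i) /\ \sum_(i < n) p i = 1.

Definition ptraceB dA dB (A : 'M[C]_(dA * dB)) : 'M[C]_dA :=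
  \matrix_(i, i') \sum_(j < dB) A (mxtens_index (i, j)) (mxtens_index (i', j)).

Definition separable dA dB (rho : 'M[C]_(dA * dB)) : Prop :=
  exists n (p : 'I_n -> R) (a : 'I_n -> 'M[C]_dA) (b : 'I_n -> 'M[C]_dB),
    is_prob p /\ (forall i, is_state (a i) /\ is_state (b i)) /\
    rho = \sum_(i < n) (p i)%:C *: (a i *t b i).

Definition rnorm (d : nat) : R := xlog2 d%:R - xlog2 (d.-1)%:R.

Definition Et_pure dA dB (v : 'cV[C]_(dA * dB)) : R :=
  St (@ptraceB dA dB (proj v)) / rnorm dA.

Definition Et dA dB (rho : 'M[C]_(dA * dB)) : R :=
  inf [set x : R | exists n (p : 'I_n -> R) (v : 'I_n -> 'cV[C]_(dA * dB)),
         [/\ is_prob p, (forall i, unit_vec (v i)),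
             rho = \sum_(i < n) (p i)%:C *: proj (v i) &
             x = \sum_(i < n) p i * @Et_pure dA dB (v i)]].

(* A protocol is a finite tree: at each node one party (A or B) applies a local
   quantum instrument given by Kraus operators K_0..K_{n-1} (the outcome i is
   broadcast classically), and the protocol continues with the subtree chosen
   by i.  Each leaf carries the final classical outcome label j : 'I_m
   (several leaves may carry the same label: coarse graining). *)
Inductive locc (dA dB m : nat) : Type :=
  | LLeaf of 'I_m
  | LNodeA (n : nat) of ('I_n -> 'M[C]_dA) & ('I_n -> locc dA dB m)
  | LNodeB (n : nat) of ('I_n -> 'M[C]_dB) & ('I_n -> locc dA dB m).

Fixpoint locc_valid dA dB m (t : locc dA dB m) : Prop :=
  match t with
  | LLeaf _ => True
  | LNodeA n K nx => \sum_(i < n) (K i) ^t* *m K i = 1%:M /\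
                     forall i, locc_valid (nx i)
  | LNodeB n K nx => \sum_(i < n) (K i) ^t* *m K i = 1%:M /\
                     forall i, locc_valid (nx i)
  end.

Fixpoint locc_kraus dA dB m (t : locc dA dB m) : seq ('I_m * 'M[C]_(dA * dB)) :=
  match t with
  | LLeaf j => [:: (j, 1%:M)]
  | LNodeA n K nx =>
      flatten [seq [seq (q.1, q.2 *m (K i *t (1%:M : 'M[C]_dB))) | q <- locc_kraus (nx i)]
              | i <- enum 'I_n]
  | LNodeB n K nx =>
      flatten [seq [seq (q.1, q.2 *m ((1%:M : 'M[C]_dA) *t K i)) | q <- locc_kraus (nx i)]
              | i <- enum 'I_n]
  end.

Definition locc_out dA dB m (t : locc dA dB m) (j : 'I_m) (rho : 'M[C]_(dA * dB))
  : 'M[C]_(dA * dB) :=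
  \sum_(q <- locc_kraus t | q.1 == j) q.2 *m rho *m q.2 ^t*.

Definition locc_prob dA dB m (t : locc dA dB m) j rho : R :=
  complex.Re (\tr (locc_out t j rho)).
Definition locc_state dA dB m (t : locc dA dB m) j rho : 'M[C]_(dA * dB) :=
  ((locc_prob t j rho)%:C)^-1 *: locc_out t j rho.

End Entanglement.

Arguments ptraceB {R} dA dB A.
Arguments Et_pure {R} dA dB v.
Arguments Et {R} dA dB rho.
Arguments separable {R} dA dB rho.

(* Main.v *)
(* E_t(psi) = sum_k h(t, l_k) / r, where the l_k are the eigenvalues of the
   reduced (unnormalised) state, t is its trace and h is the perspective of the
   binary entropy.  The log-sum inequality makes h superadditive, and with
   Peierls' inequality the spectral functional is superadditive on positive
   matrices; it also agrees on X X^* and X^* X.  Hence a local measurement on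
   either side does not increase E_t of a pure state on average, which gives
   (E2)-(E4) by working with ensembles of unnormalised vectors.  For (E1), h
   dominates x (t - x), so E_t bounds the sum of the squared 2x2 minors of the
   coefficient matrix.  By Caratheodory the near-optimal ensembles may be taken
   of bounded size, and by compactness a limit ensemble has vanishing minors,
   i.e. consists of product vectors. *)
Require Import Defs.
From HB Require Import structures.
From mathcomp Require Import all_boot all_order all_algebra.
From mathcomp Require Import complex mxtens ring lra.
From mathcomp Require Import boolp classical_sets reals exp.
From mathcomp Require Import topology normedtype derive.

Import Order.TTheory GRing.Theory Num.Theory.
Import numFieldNormedType.Exports.
Set Implicit Arguments.
Unset Strict Implicit.
Unset Printing Implicit Defensive.
Local Open Scope ring_scope.
Local Open Scope sesquilinear_scope.
Local Open Scope complex_scope.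

(** * Scalar inequalities for the perspective of the binary entropy *)

Section Scalar.
Variable R : realType.
Implicit Types x t c : R.

Lemma ln2_gt0 : 0 < ln 2 :> R.
Proof. by apply: ln_gt0; rewrite ltr1n. Qed.

Lemma xlog2E x : xlog2 x = x * ln x / ln 2.
Proof. by rewrite /xlog2; case: eqVneq => // ->; rewrite !mul0r. Qed.

(* The perspective t * gbin (x / t) of the binary entropy, extended by 0 at
   t = 0. *)
Definition gpersp t x : R := xlog2 t - xlog2 x - xlog2 (t - x).

Lemma gpersp1 x : gpersp 1 x = gbin x.
Proof. by rewrite /gpersp /gbin xlog2E ln1 mulr0 mul0r sub0r. Qed.

Lemma gpersp0 t : gpersp t 0 = 0.
Proof. by rewrite /gpersp subr0 [xlog2 0]xlog2E !mul0r subr0 subrr. Qed.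

Lemma gpersptt t : gpersp t t = 0.
Proof. by rewrite /gpersp !subrr [xlog2 0]xlog2E !mul0r subr0. Qed.

Let ln_leB1 z : 0 < z -> ln z <= z - 1 :> R.
Proof.
by move=> z0; have := @le_ln1Dx R (z - 1); rewrite addrCA subrr addr0; apply; lra.
Qed.

(** The log-sum term x ln (t / x), written with a difference of logarithms so that it is 0 at x =
    0. *)
Let L x t : R := x * (ln t - ln x).

Let gperspE t x : gpersp t x * ln 2 = L x t + L (t - x) t.
Proof.
rewrite /gpersp /L !xlog2E; have := ln2_gt0; set l := ln 2 => l0.
by field; lra.
Qed.

(* Gibbs' inequality, from ln z <= z - 1 at z = (t X) / (x T). *)
Let L_le x t X T : 0 <= x -> x <= t -> 0 < X -> 0 < T ->
  L x t <= x * (ln T - ln X) + t * X / T - x.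
Proof.
move=> x0 xt X0 T0; rewrite /L.
have [->|xn] := eqVneq x 0.
  rewrite !mul0r add0r subr0 divr_ge0 ?(ltW T0) ?mulr_ge0 ?(ltW X0) //.
  exact: le_trans xt.
have xp : 0 < x by rewrite lt_def xn.
have tp : 0 < t by apply: lt_le_trans xt.
pose z := t * X / (x * T).
have zp : 0 < z by rewrite divr_gt0 ?mulr_gt0.
have lz := ln_leB1 zp.
have -> : t * X / T = x * z by rewrite /z; field; rewrite !gt_eqF.
have -> : ln t = ln z - ln X + (ln x + ln T).
  by rewrite /z ln_div ?posrE ?mulr_gt0 // !lnM ?posrE //; ring.
nra.
Qed.

(** The log-sum inequality: [L_le] is used for both pairs with the common reference X = x1 + x2, T =
    t1 + t2, and the linear corrections t_i X / T - x_i cancel in the sum. *)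
Let L_super x1 t1 x2 t2 : 0 <= x1 <= t1 -> 0 <= x2 <= t2 ->
  L x1 t1 + L x2 t2 <= L (x1 + x2) (t1 + t2).
Proof.
move=> /andP[x10 x1t] /andP[x20 x2t].
have [X0|Xn] := eqVneq (x1 + x2) 0.
  have -> : x1 = 0 by lra.
  have -> : x2 = 0 by lra.
  by rewrite /L addr0 !mul0r addr0.
have X0 : 0 < x1 + x2 by rewrite lt_def Xn addr_ge0.
have T0 : 0 < t1 + t2 by lra.
have := lerD (L_le x10 x1t X0 T0) (L_le x20 x2t X0 T0).
move/le_trans; apply; rewrite le_eqVlt /L; apply/orP; left; apply/eqP.
by field; rewrite gt_eqF.
Qed.

Lemma gpersp_super x1 t1 x2 t2 : 0 <= x1 <= t1 -> 0 <= x2 <= t2 ->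
  gpersp t1 x1 + gpersp t2 x2 <= gpersp (t1 + t2) (x1 + x2).
Proof.
move=> h1 h2; rewrite -(ler_pM2r ln2_gt0) mulrDl !gperspE.
have : L (t1 - x1) t1 + L (t2 - x2) t2 <=
   L ((t1 - x1) + (t2 - x2)) (t1 + t2) by apply: L_super; lra.
have := L_super h1 h2.
have -> : t1 + t2 - (x1 + x2) = (t1 - x1) + (t2 - x2) by ring.
lra.
Qed.

Lemma gpersp_ge0 t x : 0 <= x <= t -> 0 <= gpersp t x.
Proof.
move=> xt; have /gpersp_super : 0 <= x <= x by lra.
(* Superadditivity for the splitting (t, x) = (x, x) + (t - x, 0), both of whose terms have zero
   [gpersp]. *)
move=> /(_ 0 (t - x)); rewrite gpersptt gpersp0 addr0 subrKC addr0; apply.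
lra.
Qed.

Lemma gpersp_sum (I : Type) (s : seq I) (t x : I -> R) :
  (forall i, 0 <= x i <= t i) ->
  \sum_(i <- s) gpersp (t i) (x i) <= gpersp (\sum_(i <- s) t i) (\sum_(i <- s) x i).
Proof.
move=> h; elim: s => [|i s IH]; first by rewrite !big_nil gpersp0.
rewrite !big_cons; apply: le_trans (gpersp_super (h i) _); first by rewrite lerD2l.
rewrite sumr_ge0 /= ?ler_sum //.
  by move=> j _; case/andP: (h j).
by move=> j _; case/andP: (h j).
Qed.

Lemma gperspM c t x : 0 <= c -> 0 <= x <= t -> gpersp (c * t) (c * x) = c * gpersp t x.
Proof.
move=> c0 /andP[x0 xt]; have [->|cn] := eqVneq c 0; first by rewrite !mul0r gpersp0.
have cp : 0 < c by rewrite lt_def cn.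
(* The failure of homogeneity is linear in y, so it cancels between t, x and t - x. *)
have xM y : 0 <= y -> xlog2 (c * y) = c * xlog2 y + y * (c * ln c / ln 2).
  rewrite le_eqVlt => /predU1P[<-|yp]; first by rewrite !xlog2E mulr0 !mul0r mulr0 addr0.
  rewrite !xlog2E lnM ?posrE //; ring.
by rewrite /gpersp -mulrBr !xM; first ring; lra.
Qed.

Lemma gpersp_quad t x : 0 <= x <= t -> t <= 1 -> x * (t - x) <= ln 2 * gpersp t x.
Proof.
move=> /andP[x0 xt] t1; rewrite mulrC [leRHS]mulrC gperspE.
have [t0|tn] := eqVneq t 0.
  have -> : x = 0 by lra.
  by rewrite mulr0 /L t0 subr0 mul0r addr0.
have tp : 0 < t by rewrite lt_def tn; lra.
(* Since t <= 1, - ln (y / t) >= 1 - y / t >= t - y. Hence each of the two log-sum terms making up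
   [gpersp] already dominates x (t - x). *)
have Lq y : 0 <= y -> y <= t -> y * (t - y) <= L y t.
  move=> y0 yt; rewrite /L; have [->|yn] := eqVneq y 0; first by rewrite !mul0r.
  have yp : 0 < y by rewrite lt_def yn.
  rewrite ler_wpM2l // // -[leRHS]opprB -ln_div ?posrE // lerNr.
  have /ln_leB1 : 0 < y / t by rewrite divr_gt0.
  move/le_trans; apply; rewrite -subr_ge0.
  have -> : - (t - y) - (y / t - 1) = (t - y) * (1 - t) / t by field; rewrite gt_eqF.
  by rewrite divr_ge0 ?mulr_ge0 //; lra.
have := Lq x x0 xt.
have : (t - x) * (t - (t - x)) <= L (t - x) t by apply: Lq; lra.
by have : 0 <= x * (t - x); nra.
Qed.

(** x ln x increases strictly from d - 1 to d once d - 1 >= 1. At d = 1 the constant is 0, hence the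
    assumption [1 < dA] below. *)
Lemma rnorm_gt0 d : (1 < d)%N -> 0 < rnorm R d.
Proof.
case: d => [//|[//|d]] _; rewrite /rnorm /= !xlog2E -mulrBl divr_gt0 ?ln2_gt0 //.
have l0 : 0 <= ln (d.+1%:R) :> R by apply: ln_ge0; rewrite ler1n.
have : ln (d.+1%:R) < ln (d.+2%:R) :> R by rewrite ltr_ln ?posrE ?ltr0n // ltr_nat.
have -> : d.+2%:R = d.+1%:R + 1 :> R by rewrite -natr1.
have : 0 < d.+1%:R :> R by [].
nra.
Qed.

End Scalar.

(** * Spectra of matrix products and the spectral functional on positive matrices *)

Lemma char_poly_mulC (K : comNzRingType) m n (X : 'M[K]_(m, n)) (Y : 'M[K]_(n, m)) :
  'X^n * char_poly (X *m Y) = 'X^m * char_poly (Y *m X).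
Proof.
pose x : {poly K} := 'X.
pose P := map_mx (@polyC K) X; pose Q := map_mx (@polyC K) Y.
(* Both sides come from the determinant of this one block matrix: clearing Q leaves the Schur
   complement x - P Q, and clearing P, at the cost of a factor x^n, leaves x - Q P. *)
pose M := block_mx x%:M P Q 1%:M.
have e1 : \det M = char_poly (X *m Y).
  have /(congr1 determinant) : M *m block_mx 1%:M 0 (- Q) 1%:M =
      block_mx (x%:M - P *m Q) P 0 1%:M.
    rewrite mulmx_block !mulmx1 !mulmx0 !mul1mx !mulmxN !add0r.
    by rewrite subrr.
  rewrite det_mulmx det_lblock !det1 mul1r !mulr1 => ->.
  by rewrite det_ublock det1 mulr1 /char_poly /char_poly_mx map_mxM.
have /(congr1 determinant) : M *m block_mx 1%:M (- P) 0 x%:M =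
    block_mx x%:M 0 Q (x%:M - Q *m P).
  rewrite mulmx_block !mulmx1 !mulmx0 !mul1mx !mulmxN !addr0.
  by rewrite mul_mx_scalar mul_scalar_mx addNr addrC.
rewrite det_mulmx det_ublock det_lblock !det_scalar expr1n mul1r e1 mulrC => ->.
by rewrite /char_poly /char_poly_mx map_mxM.
Qed.

Section Spectrum.
Variable R : realType.
Local Notation C := R[i].
Implicit Types m n : nat.

Lemma eigvalsP n (A : 'M[C]_n) : char_poly A = \prod_(z <- eigvals A) ('X - z%:P).
Proof.
rewrite /eigvals; case: closed_field_poly_normal => r /= {1}->.
by rewrite (monicP (char_poly_monic A)) scale1r.
Qed.

Lemma eigvals_mulC m n (X : 'M[C]_(m, n)) (Y : 'M[C]_(n, m)) :
  perm_eq (nseq n 0 ++ eigvals (X *m Y)) (nseq m 0 ++ eigvals (Y *m X)).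
Proof.
apply: prod_XsubC_eq; rewrite !big_cat /= -!eigvalsP.
have e k : \prod_(z <- nseq k 0) ('X - z%:P) = 'X^k :> {poly C}.
  by rewrite big_nseq subr0 -Monoid.iteropE.
by rewrite !e char_poly_mulC.
Qed.

(** The extension of [St] to unnormalised matrices: it agrees with [St] at trace one, and taking the
    perspective at the trace makes it homogeneous of degree one on positive matrices. *)
Definition Sh n (A : 'M[C]_n) : R :=
  \sum_(z <- eigvals A) gpersp (complex.Re (\tr A)) (complex.Re z).

(** The two spectra differ only by zeros, where [gpersp] vanishes. On a coefficient matrix this
    exchanges the reduced states of the two parties. *)
Lemma Sh_mulC m n (X : 'M[C]_(m, n)) (Y : 'M[C]_(n, m)) : Sh (X *m Y) = Sh (Y *m X).
Proof.
rewrite /Sh mxtrace_mulC; set t := complex.Re _.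
have e k (s : seq C) : \sum_(z <- s) gpersp t (complex.Re z) =
    \sum_(z <- nseq k 0 ++ s) gpersp t (complex.Re z).
  by rewrite big_cat /= big_nseq gpersp0 iter_addr_0 mul0rn add0r.
by rewrite (e n) [RHS](e m); apply/perm_big/eigvals_mulC.
Qed.

Lemma Sh_diag n (d : 'rV[C]_n) :
  Sh (diag_mx d) = \sum_i gpersp (complex.Re (\sum_j d 0 j)) (complex.Re (d 0 i)).
Proof.
rewrite /Sh mxtrace_diag.
have /(perm_big _)-> : perm_eq (eigvals (diag_mx d)) [seq d 0 i | i <- enum 'I_n].
  apply: prod_XsubC_eq; rewrite -eigvalsP char_poly_trig ?diag_mx_is_trig // big_map big_enum.
  by apply: eq_bigr => i _; rewrite mxE eqxx.
by rewrite big_map big_enum.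
Qed.

Lemma unitary_mul1 n (U : 'M[C]_n) : U \is unitarymx -> U ^t* *m U = 1%:M.
Proof. by move=> /unitarymxP/mulmx1C. Qed.

Lemma Sh_conj n (U A : 'M[C]_n) : U \is unitarymx -> Sh (U ^t* *m A *m U) = Sh A.
Proof. by move=> /unitarymxP h; rewrite -mulmxA Sh_mulC -mulmxA h mulmx1. Qed.

Lemma ctM m n p (A : 'M[C]_(m, n)) (B : 'M[C]_(n, p)) : (A *m B) ^t* = B ^t* *m A ^t*.
Proof. by rewrite trmx_mul map_mxM. Qed.

Lemma ctD m n (A B : 'M[C]_(m, n)) : (A + B) ^t* = A ^t* + B ^t*.
Proof. by apply/matrixP => i j; rewrite !mxE rmorphD. Qed.

Lemma ct_sum m n (I : Type) (s : seq I) (P : pred I) (F : I -> 'M[C]_(m, n)) :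
  (\sum_(i <- s | P i) F i) ^t* = \sum_(i <- s | P i) (F i) ^t*.
Proof.
apply: (big_morph (fun A : 'M[C]_(m, n) => A ^t*)) => [x y|]; first exact: ctD.
by rewrite trmx0 map_mx0.
Qed.

Lemma ctZ m n (c : R) (A : 'M[C]_(m, n)) : (c%:C *: A) ^t* = c%:C *: A ^t*.
Proof. by apply/matrixP => i j; rewrite !mxE rmorphM; congr (_ * _); exact: conjc_real. Qed.

Lemma Re_sum (I : Type) (s : seq I) (P : pred I) (F : I -> C) :
  complex.Re (\sum_(i <- s | P i) F i) = \sum_(i <- s | P i) complex.Re (F i).
Proof. by apply: (big_morph (@complex.Re R)) => // -[a b] [c d]. Qed.

Lemma Im_sum (I : Type) (s : seq I) (P : pred I) (F : I -> C) :
  complex.Im (\sum_(i <- s | P i) F i) = \sum_(i <- s | P i) complex.Im (F i).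
Proof. by apply: (big_morph (@complex.Im R)) => // -[a b] [c d]. Qed.

Lemma ReZ (c : R) (z : C) : complex.Re (c%:C * z) = c * complex.Re z.
Proof. by case: z => a b /=; rewrite mul0r subr0. Qed.

Lemma ge0_Re (z : C) : 0 <= z -> z = (complex.Re z)%:C.
Proof. by move=> z0; rewrite RRe_real // ger0_real. Qed.

Lemma Re_ge0 (z : C) : 0 <= z -> 0 <= complex.Re z.
Proof. by move=> z0; rewrite -ler0c -ge0_Re. Qed.

Lemma gram_diag_ge0 m n (X : 'M[C]_(m, n)) i : 0 <= (X *m X ^t*) i i.
Proof. by rewrite mxE sumr_ge0 // => j _; rewrite !mxE mul_conjC_ge0. Qed.

Lemma psd_gram m n (X : 'M[C]_(m, n)) : psd (X *m X ^t*).
Proof.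
split; first by rewrite /Defs.hermitian ctM trmxCK.
move=> x; rewrite mulmxA -mulmxA.
by rewrite -{1}[X]trmxCK -ctM -{2}[_ *m x]trmxCK gram_diag_ge0.
Qed.

Lemma psd_sum n (I : Type) (s : seq I) (P : pred I) (F : I -> 'M[C]_n) :
  (forall i, psd (F i)) -> psd (\sum_(i <- s | P i) F i).
Proof.
move=> h; split; first by rewrite /Defs.hermitian ct_sum; apply: eq_bigr => i _; case: (h i).
move=> x; rewrite mulmx_sumr mulmx_suml summxE sumr_ge0 // => i _.
by case: (h i) => _; apply.
Qed.

Lemma psd_conj m n (X : 'M[C]_(m, n)) (A : 'M[C]_n) : psd A -> psd (X *m A *m X ^t*).
Proof.
move=> [hA pA]; split; first by rewrite /Defs.hermitian !ctM trmxCK hA mulmxA.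
by move=> x; have := pA (X ^t* *m x); rewrite ctM trmxCK !mulmxA.
Qed.

Lemma psd_diag n (A : 'M[C]_n) i : psd A -> 0 <= A i i.
Proof.
move=> [_ /(_ (delta_mx i 0))]; rewrite trmx_delta map_delta_mx.
by rewrite -rowE -colE !mxE.
Qed.

Lemma psd_spectral n (A : 'M[C]_n) : psd A ->
  exists (U : 'M[C]_n) (d : 'I_n -> R),
   [/\ U \is unitarymx, forall i, 0 <= d i &
       A = U ^t* *m diag_mx (\row_i (d i)%:C) *m U].
Proof.
move=> pA; have [hA _] := pA.
have /hermitian_normalmx/orthomx_spectralP : A \is hermsymmx.
  by apply/is_hermitianmxP; rewrite expr0 scale1r hA.
set U := spectralmx A; set d := spectral_diag A => eA.
have uU : U \is unitarymx := spectral_unitarymx A.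
rewrite invmx_unitary // in eA.
have dE : U *m A *m U ^t* = diag_mx d.
  by rewrite eA !mulmxA (unitarymxP uU) mul1mx -mulmxA (unitarymxP uU) mulmx1.
(* The eigenvalues are diagonal entries of a unitary conjugate of A, which is still positive. *)
have d0 i : 0 <= d 0 i.
  by have := psd_diag i (psd_conj U pA); rewrite dE mxE eqxx mulr1n.
exists U, (fun i => complex.Re (d 0 i)); split => //.
- by move=> i; apply: Re_ge0.
- rewrite {1}eA; congr (_ *m diag_mx _ *m _).
  by apply/rowP => i; rewrite mxE -ge0_Re.
Qed.

Lemma spectral_trace n (U : 'M[C]_n) (d : 'I_n -> R) : U \is unitarymx ->
  \tr (U ^t* *m diag_mx (\row_i (d i)%:C) *m U) = (\sum_i d i)%:C.
Proof.
move=> /unitarymxP uU; rewrite -mulmxA mxtrace_mulC -mulmxA uU mulmx1.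
by rewrite mxtrace_diag rmorph_sum /=; apply: eq_bigr => i _; rewrite mxE.
Qed.

Lemma Sh_spectral n (U : 'M[C]_n) (d : 'I_n -> R) : U \is unitarymx ->
  Sh (U ^t* *m diag_mx (\row_i (d i)%:C) *m U) = \sum_i gpersp (\sum_j d j) (d i).
Proof.
move=> uU; rewrite Sh_conj // Sh_diag.
rewrite Re_sum; under [X in gpersp X]eq_bigr do rewrite mxE /=.
by apply: eq_bigr => i _; rewrite mxE.
Qed.

Lemma le_sum_term n (d : 'I_n -> R) i : (forall i, 0 <= d i) -> 0 <= d i <= \sum_j d j.
Proof. by move=> d0; rewrite d0 (bigD1 i) //= lerDl sumr_ge0. Qed.

Lemma Sh_ge0 n (A : 'M[C]_n) : psd A -> 0 <= Sh A.
Proof.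
case/psd_spectral => U [d [uU d0 ->]]; rewrite Sh_spectral // sumr_ge0 // => i _.
by rewrite gpersp_ge0 // le_sum_term.
Qed.

Lemma ShZ n (c : R) (A : 'M[C]_n) : 0 <= c -> psd A -> Sh (c%:C *: A) = c * Sh A.
Proof.
move=> c0; case/psd_spectral => U [d [uU d0 ->]]; rewrite Sh_spectral //.
rewrite scalemxAl scalemxAr -linearZ /=.
have -> : c%:C *: (\row_i (d i)%:C) = \row_i ((c * d i)%:C).
  by apply/rowP => i; rewrite !mxE rmorphM.
rewrite Sh_spectral // mulr_sumr; apply: eq_bigr => i _.
by rewrite -mulr_sumr gperspM // le_sum_term.
Qed.

Lemma unitary_row_norm n (W : 'M[C]_n) : W \is unitarymx ->
  forall k, \sum_l complex.Re (W k l * (W k l)^*) = 1.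
Proof.
move=> /unitarymxP uW k; have /matrixP/(_ k k) := uW; rewrite !mxE eqxx mulr1n.
move=> /(congr1 (@complex.Re R)); rewrite Re_sum => h.
by rewrite -[RHS]h; apply: eq_bigr => l _; rewrite !mxE.
Qed.

(* Peierls' inequality: the diagonal entries of U A U^* are averages of the
   eigenvalues of A with doubly stochastic weights. *)
Lemma Sh_le_diag n (A U : 'M[C]_n) : psd A -> U \is unitarymx ->
  Sh A <= \sum_k gpersp (complex.Re (\tr A)) (complex.Re ((U *m A *m U ^t*) k k)).
Proof.
move=> pA uU; case/psd_spectral: pA => V [d [uV d0 ->]].
rewrite Sh_spectral // spectral_trace //=; set t := \sum_j d j.
pose W := U *m V ^t*.
have uW : W \is unitarymx by rewrite mul_unitarymx // trmxC_unitary.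
pose q k l := complex.Re (W k l * (W k l)^*).
have q0 k l : 0 <= q k l by apply/Re_ge0/mul_conjC_ge0.
have qr k : \sum_l q k l = 1 by apply: unitary_row_norm.
have qc l : \sum_k q k l = 1.
  have uW' : W ^t* \is unitarymx by rewrite trmxC_unitary.
  rewrite -[RHS](unitary_row_norm uW' l); apply: eq_bigr => k _.
  by rewrite /q !mxE conjCK mulrC.
have e k : complex.Re ((U *m (V ^t* *m diag_mx (\row_i (d i)%:C) *m V) *m U ^t*) k k) = \sum_l q k l * d l.
  have -> : U *m (V ^t* *m diag_mx (\row_i (d i)%:C) *m V) *m U ^t* =
      W *m diag_mx (\row_i (d i)%:C) *m W ^t*.
    by rewrite /W ctM trmxCK !mulmxA.
  rewrite mxE Re_sum; apply: eq_bigr => l _.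
  rewrite mul_mx_diag !mxE mulrAC mulrC ReZ mulrC; congr (complex.Re _ * _).
  by rewrite !mxE.
(* Column sums equal to one insert the weights on the left. Row sums equal to one then rewrite t as
   the sum of q k l * t, so that Jensen's inequality becomes homogeneity and superadditivity of
   [gpersp]. *)
apply: (@le_trans _ _ (\sum_l \sum_k q k l * gpersp t (d l))).
  by apply: ler_sum => l _; rewrite -mulr_suml qc mul1r.
rewrite exchange_big /=; apply: ler_sum => k _.
rewrite e -{2}[t]mul1r -(qr k) mulr_suml.
under eq_bigr do rewrite -gperspM ?le_sum_term //.
by apply: gpersp_sum => l; rewrite mulr_ge0 // ler_wpM2l //; case/andP: (le_sum_term l d0).
Qed.

Lemma psd_trace_diag n (A U : 'M[C]_n) k : psd A -> U \is unitarymx ->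
  0 <= complex.Re ((U *m A *m U ^t*) k k) <= complex.Re (\tr A).
Proof.
move=> pA uU; have pB := psd_conj U pA.
rewrite Re_ge0 ?psd_diag //=.
have -> : \tr A = \tr (U *m A *m U ^t*).
  by rewrite mxtrace_mulC mulmxA unitary_mul1 // mul1mx.
rewrite Re_sum (bigD1 k) //= lerDl sumr_ge0 // => i _.
by rewrite Re_ge0 ?psd_diag.
Qed.

(** In a basis U diagonalising the sum, the right side is computed exactly from diagonal entries,
    while Peierls' inequality bounds each summand by its own diagonal in that basis. What remains is
    superadditivity of [gpersp] at each diagonal position. *)
Lemma Sh_super n (I : Type) (s : seq I) (F : I -> 'M[C]_n) : (forall i, psd (F i)) ->
  \sum_(i <- s) Sh (F i) <= Sh (\sum_(i <- s) F i).
Proof.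
move=> pF; case/psd_spectral: (psd_sum s xpredT pF) => U [d [uU d0 eA]].
rewrite eA Sh_spectral //.
apply: (@le_trans _ _ (\sum_(i <- s) \sum_k gpersp (complex.Re (\tr (F i)))
    (complex.Re ((U *m F i *m U ^t*) k k)))).
  by apply: ler_sum => i _; apply: Sh_le_diag.
rewrite exchange_big /=; apply: ler_sum => k _.
have -> : \sum_j d j = \sum_(i <- s) complex.Re (\tr (F i)).
  rewrite -Re_sum; transitivity (complex.Re (\tr (\sum_(i <- s) F i))).
    by rewrite eA spectral_trace.
  by rewrite (raddf_sum (@mxtrace _ _)).
have -> : d k = \sum_(i <- s) complex.Re ((U *m F i *m U ^t*) k k).
  rewrite -Re_sum -summxE -mulmx_suml -mulmx_sumr eA.
  rewrite !mulmxA (unitarymxP uU) mul1mx -mulmxA (unitarymxP uU) mulmx1.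
  by rewrite !mxE eqxx.
by apply: gpersp_sum => i; apply: psd_trace_diag.
Qed.

(** In terms of the eigenvalues the left side is the sum of d_i (t - d_i), so [gpersp_quad] applies
    term by term. *)
Lemma Sh_quad n (A : 'M[C]_n) : psd A -> complex.Re (\tr A) <= 1 ->
  complex.Re ((\tr A) ^+ 2 - \tr (A *m A)) <= ln 2 * Sh A.
Proof.
case/psd_spectral => U [d [uU d0 ->]]; rewrite Sh_spectral // spectral_trace //=.
set D := diag_mx _; set t := \sum_j d j => t1.
have -> : U ^t* *m D *m U *m (U ^t* *m D *m U) = U ^t* *m diag_mx (\row_i (d i ^+ 2)%:C) *m U.
  rewrite !mulmxA -[_ *m U *m U ^t*]mulmxA (unitarymxP uU) mulmx1 -[_ *m D *m D]mulmxA.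
  rewrite mulmx_diag; congr (_ *m diag_mx _ *m _).
  by apply/rowP => i; rewrite !mxE expr2 rmorphM.
rewrite spectral_trace // -rmorphXn -rmorphB /= mulr_sumr expr2 mulr_suml -sumrB.
apply: ler_sum => i _; rewrite expr2 -mulrBr gpersp_quad // le_sum_term //.
Qed.

End Spectrum.

(** * Pure states: coefficient matrices and local measurements *)

Section Bipartite.
Variables (R : realType) (dA dB : nat).
Local Notation C := R[i].
Local Notation vec := ('cV[C]_(dA * dB)).
Implicit Types rho : 'M[C]_(dA * dB).

(** The coefficient matrix W of a bipartite vector. Operators of A act on it from the left, those of
    B from the right through their transpose, and the reduced state of A is W W^*. *)
Definition Wmx (w : vec) : 'M[C]_(dA, dB) := \matrix_(i, j) w (mxtens_index (i, j)) 0.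

Lemma sum_mxtens (V : nmodType) (F : 'I_(dA * dB) -> V) :
  \sum_k F k = \sum_i \sum_j F (mxtens_index (i, j)).
Proof.
rewrite pair_big /=; apply: reindex.
by exists (@mxtens_unindex dA dB) => ? _; rewrite ?mxtens_indexK ?mxtens_unindexK // -surjective_pairing.
Qed.

Lemma ptraceB_proj w : ptraceB dA dB (proj w) = Wmx w *m (Wmx w) ^t*.
Proof.
apply/matrixP => i i'; rewrite !mxE; apply: eq_bigr => j _.
by rewrite !mxE big_ord1 !mxE.
Qed.

Lemma Wmx_tens (A : 'M[C]_dA) (B : 'M[C]_dB) w :
  Wmx ((A *t B) *m w) = A *m Wmx w *m B^T.
Proof.
apply/matrixP => i j; rewrite !mxE sum_mxtens.
under [RHS]eq_bigr do rewrite !mxE mulr_suml.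
rewrite exchange_big /=; apply: eq_bigr => k _; apply: eq_bigr => l _.
by rewrite tensmxE !mxE mulrAC.
Qed.

Lemma WmxZ (c : C) w : Wmx (c *: w) = c *: Wmx w.
Proof. by apply/matrixP => i j; rewrite !mxE. Qed.

Lemma Wmx_prod (a : 'cV[C]_dA) (b : 'cV[C]_dB) : Wmx (a *t b) = a *m b^T.
Proof.
apply/matrixP => i j; rewrite !mxE big_ord1 !mxE mxtens_indexK /=.
by congr (a _ _ * b _ _); apply: ord1.
Qed.

Definition nrm2 n (w : 'cV[C]_n) : R := complex.Re ((w ^t* *m w) 0 0).

Lemma nrm2_ge0C n (w : 'cV[C]_n) : 0 <= (w ^t* *m w) 0 0.
Proof. by rewrite -{2}[w]trmxCK gram_diag_ge0. Qed.

Lemma nrm2E n (w : 'cV[C]_n) : (w ^t* *m w) 0 0 = (nrm2 w)%:C.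
Proof. exact/ge0_Re/nrm2_ge0C. Qed.

Lemma nrm2_ge0 n (w : 'cV[C]_n) : 0 <= nrm2 w.
Proof. exact/Re_ge0/nrm2_ge0C. Qed.

Lemma nrm2_eq0 n (w : 'cV[C]_n) : nrm2 w = 0 -> w = 0.
Proof.
move=> w0; have := nrm2E w; rewrite w0 mxE => /eqP.
rewrite psumr_eq0 => [/allP h|i _]; last by rewrite !mxE mulrC mul_conjC_ge0.
apply/matrixP => i j; rewrite ord1 mxE.
have := h i (mem_index_enum _); rewrite /= !mxE mulf_eq0 conjC_eq0 orbb.
by move/eqP.
Qed.

Lemma trace_proj n (w : 'cV[C]_n) : \tr (proj w) = (nrm2 w)%:C.
Proof. by rewrite mxtrace_mulC /mxtrace big_ord1 nrm2E. Qed.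

Lemma trace_Wmx w : \tr (Wmx w *m (Wmx w) ^t*) = (nrm2 w)%:C.
Proof.
rewrite -ptraceB_proj -trace_proj /mxtrace sum_mxtens.
by apply: eq_bigr => i _; rewrite mxE.
Qed.

Lemma projZ n (c : R) (w : 'cV[C]_n) : proj (c%:C *: w) = (c ^+ 2)%:C *: proj w.
Proof. by rewrite /proj ctZ -scalemxAl -scalemxAr scalerA -rmorphM. Qed.

Lemma nrm2Z n (c : R) (w : 'cV[C]_n) : nrm2 (c%:C *: w) = c ^+ 2 * nrm2 w.
Proof. by rewrite /nrm2 ctZ -scalemxAl -scalemxAr scalerA mxE -rmorphM ReZ. Qed.

Lemma projM m n (K : 'M[C]_(m, n)) w : proj (K *m w) = K *m proj w *m K ^t*.
Proof. by rewrite /proj ctM !mulmxA. Qed.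

(* [nrm2 w] times the entanglement of the normalisation of [w]. *)
Definition Eu (w : vec) : R := Sh (Wmx w *m (Wmx w) ^t*) / rnorm R dA.

Lemma Eu_ge0 w : (1 < dA)%N -> 0 <= Eu w.
Proof. by move=> hA; rewrite divr_ge0 ?(ltW (rnorm_gt0 _ hA)) // Sh_ge0 //; apply: psd_gram. Qed.

Lemma EuZ (c : R) w : Eu (c%:C *: w) = c ^+ 2 * Eu w.
Proof.
rewrite /Eu WmxZ ctZ -scalemxAl -scalemxAr scalerA -rmorphM ShZ ?mulrA //.
  by rewrite -expr2 sqr_ge0.
exact: psd_gram.
Qed.

Lemma Eu0 : Eu 0 = 0.
Proof. by rewrite -(scale0r 0) (EuZ 0) expr0n mul0r. Qed.

Lemma Et_pureE v : unit_vec v -> Et_pure dA dB v = Eu v.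
Proof.
move=> uv; rewrite /Et_pure /Eu /St /Sh ptraceB_proj trace_Wmx /nrm2 uv /=.
by under [in RHS]eq_bigr do rewrite gpersp1.
Qed.

Lemma Eu_prod (a : 'cV[C]_dA) (b : 'cV[C]_dB) : Eu (a *t b) = 0.
Proof.
rewrite /Eu Wmx_prod ctM mulmxA -[a *m _ *m _]mulmxA.
have -> : b^T *m b^T ^t* = (nrm2 b)%:C%:M.
  apply/matrixP => i j; rewrite !ord1 -nrm2E !mxE eqxx mulr1n; apply: eq_bigr => k _.
  by rewrite !mxE mulrC.
rewrite mul_mx_scalar -scalemxAl ShZ ?nrm2_ge0 //; last exact: psd_gram.
(* After the swap the matrix is 1 x 1, and its only eigenvalue equals its trace. *)
rewrite Sh_mulC.
have -> : a ^t* *m a = diag_mx (\row_i (nrm2 a)%:C).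
  by apply/matrixP => i j; rewrite !ord1 nrm2E !mxE eqxx mulr1n.
by rewrite Sh_diag !big_ord1 mxE gpersptt mulr0 mul0r.
Qed.

(** A measurement by A preserves W^* W on average, by completeness of the Kraus operators. [Sh_mulC]
    moves the entropy to that side, where superadditivity concludes. *)
Lemma Eu_instrA n (K : 'I_n -> 'M[C]_dA) w : (1 < dA)%N ->
  \sum_i (K i) ^t* *m K i = 1%:M ->
  \sum_i Eu ((K i *t 1%:M) *m w) <= Eu w.
Proof.
move=> hA hK; rewrite /Eu -mulr_suml ler_pM2r ?invr_gt0 ?rnorm_gt0 //.
rewrite [leRHS]Sh_mulC.
have -> : (Wmx w) ^t* *m Wmx w = \sum_i (K i *m Wmx w) ^t* *m (K i *m Wmx w).
  rewrite -{2}[Wmx w]mul1mx -hK mulmx_suml mulmx_sumr; apply: eq_bigr => i _.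
  by rewrite ctM !mulmxA.
apply: le_trans (Sh_super _ _); last first.
  by move=> i; rewrite -{2}[_ *m Wmx w]trmxCK; apply: psd_gram.
apply: ler_sum => i _.
by rewrite Wmx_tens trmx1 mulmx1 Sh_mulC.
Qed.

(** A measurement by B preserves W W^* on average, so superadditivity applies directly. Completeness
    is needed in transposed form because B acts through K^T. *)
Lemma Eu_instrB n (K : 'I_n -> 'M[C]_dB) w : (1 < dA)%N ->
  \sum_i (K i) ^t* *m K i = 1%:M ->
  \sum_i Eu ((1%:M *t K i) *m w) <= Eu w.
Proof.
move=> hA hK; rewrite /Eu -mulr_suml ler_pM2r ?invr_gt0 ?rnorm_gt0 //.
have -> : Wmx w *m (Wmx w) ^t* =
    \sum_i (Wmx w *m (K i)^T) *m (Wmx w *m (K i)^T) ^t*.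
  have /(congr1 trmx) := hK; rewrite raddf_sum /= trmx1 => hK'.
  rewrite -{1}[Wmx w]mulmx1 -hK' mulmx_sumr mulmx_suml; apply: eq_bigr => i _.
  by rewrite ctM trmx_mul !mulmxA map_trmx !trmxK.
apply: le_trans (Sh_super _ _); last by move=> i; apply: psd_gram.
by apply: ler_sum => i _; rewrite Wmx_tens mul1mx.
Qed.

(** Induction on the protocol tree: the root measurement does not increase [Eu] on average, and each
    subtree is applied to the vector its outcome leaves. *)
Lemma Eu_locc m (t : locc R dA dB m) w : (1 < dA)%N -> locc_valid t ->
  \sum_(q <- locc_kraus t) Eu (q.2 *m w) <= Eu w.
Proof.
move=> hA; elim: t w => [j|n K nx IH|n K nx IH] w /=.
- by rewrite big_seq1 mul1mx.
- case=> hK hv; apply: le_trans (Eu_instrA w hA hK).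
  rewrite big_flatten big_map big_enum /=; apply: ler_sum => i _.
  rewrite big_map /=; under eq_bigr do rewrite -mulmxA.
  exact: IH.
- case=> hK hv; apply: le_trans (Eu_instrB w hA hK).
  rewrite big_flatten big_map big_enum /=; apply: ler_sum => i _.
  rewrite big_map /=; under eq_bigr do rewrite -mulmxA.
  exact: IH.
Qed.

(** * Mixed states: ensembles of unnormalised vectors and the infimum *)

Lemma psd_ensemble n (A : 'M[C]_n) : psd A -> exists s : seq 'cV[C]_n, A = \sum_(w <- s) proj w.
Proof.
case/psd_spectral => U [d [uU d0 ->]].
exists [seq (Num.sqrt (d i))%:C *: (col i (U ^t*)) | i <- enum 'I_n].
rewrite big_map big_enum /=.
apply/matrixP => i j; rewrite summxE mul_mx_diag mxE; apply: eq_bigr => k _.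
rewrite projZ sqr_sqrtr // !mxE big_ord1 !mxE conjCK.
by rewrite mulrAC mulrC mulrA.
Qed.

Local Open Scope classical_set_scope.

Definition Et_set (rho : 'M[C]_(dA * dB)) : set R :=
  [set x : R | exists n (p : 'I_n -> R) (v : 'I_n -> 'cV[C]_(dA * dB)),
         [/\ is_prob p, (forall i, unit_vec (v i)),
             rho = \sum_(i < n) (p i)%:C *: proj (v i) &
             x = \sum_(i < n) p i * @Et_pure R dA dB (v i)]].

(** Passes from a list of unnormalised vectors to a decomposition into unit vectors, with squared
    norms over p as probabilities. The factor p lets it apply to unnormalised LOCC outcomes. *)
Lemma Et_set_ensemble (p : R) (rho : 'M[C]_(dA * dB)) (s : seq vec) :
  0 < p -> \tr rho = 1 -> p%:C *: rho = \sum_(w <- s) proj w ->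
  Et_set rho ((\sum_(w <- s) Eu w) / p).
Proof.
(* Zero vectors cannot be normalised; they are dropped, as they contribute nothing to either sum. *)
move=> p0 t1 es; pose s' := [seq w <- s | w != 0].
have sE (V : nmodType) (F : vec -> V) : F 0 = 0 ->
    \sum_(w <- s) F w = \sum_(i < size s') F s'`_i.
  move=> F0; transitivity (\sum_(w <- s') F w); last by rewrite (big_nth 0) big_mkord.
  by rewrite big_filter [RHS]big_mkcond; apply: eq_bigr => w _; case: eqVneq => //= ->.
have n0 (i : 'I_(size s')) : 0 < nrm2 s'`_i.
  rewrite lt_def nrm2_ge0 andbT; apply/eqP => /nrm2_eq0 e.
  by have := mem_nth 0 (ltn_ord i); rewrite mem_filter e eqxx.
pose c (i : 'I_(size s')) := (Num.sqrt (nrm2 s'`_i))^-1.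
have c2 i : c i ^+ 2 = (nrm2 s'`_i)^-1 by rewrite exprVn sqr_sqrtr // ltW.
exists (size s'), (fun i => nrm2 s'`_i / p), (fun i => (c i)%:C *: s'`_i).
have uv i : unit_vec ((c i)%:C *: s'`_i).
  by rewrite /unit_vec nrm2E nrm2Z c2 mulVf // gt_eqF.
have proj0 n : proj (0 : 'cV[C]_n) = 0 by rewrite /proj mul0mx.
split => //.
- split=> [i|]; first by rewrite divr_ge0 ?nrm2_ge0 ?ltW.
  rewrite -mulr_suml; have /(congr1 mxtrace) := es.
  rewrite linearZ /= t1 mulr1 (sE _ (@proj R _)) ?proj0 // (raddf_sum (@mxtrace _ _)) /=.
  under eq_bigr do rewrite trace_proj.
  by rewrite -rmorph_sum => /complexI <-; rewrite divff // gt_eqF.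
- apply: (scalerI (lt0r_neq0 (_ : 0 < p%:C))); first by rewrite ltcR.
  rewrite es (sE _ (@proj R _)) ?proj0 // scaler_sumr; apply: eq_bigr => i _.
  rewrite projZ c2 !scalerA -!rmorphM.
  have -> : p * (nrm2 s'`_i / p / nrm2 s'`_i) = 1.
    by field; rewrite !gt_eqF ?n0.
  by rewrite rmorph1 scale1r.
- rewrite (sE _ Eu) ?Eu0 // mulr_suml; apply: eq_bigr => i _.
  by rewrite Et_pureE // EuZ c2 mulrACA divff ?gt_eqF ?n0 // mul1r mulrC.
Qed.

Lemma Et_set_ge0 rho x : (1 < dA)%N -> Et_set rho x -> 0 <= x.
Proof.
move=> hA [n [p [v [[p0 _] uv _ ->]]]]; apply: sumr_ge0 => i _.
by rewrite mulr_ge0 // Et_pureE // Eu_ge0.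
Qed.

Lemma Et_set_lb rho : (1 < dA)%N -> has_lbound (Et_set rho).
Proof. by move=> hA; exists 0 => x; apply: Et_set_ge0. Qed.

Lemma Et_le (p : R) (rho : 'M[C]_(dA * dB)) (s : seq vec) : (1 < dA)%N ->
  0 < p -> \tr rho = 1 -> p%:C *: rho = \sum_(w <- s) proj w ->
  p * Et dA dB rho <= \sum_(w <- s) Eu w.
Proof.
move=> hA p0 t1 es; rewrite mulrC -ler_pdivlMr //.
exact/(ge_inf (Et_set_lb rho hA))/Et_set_ensemble.
Qed.

Lemma Et_le1 (rho : 'M[C]_(dA * dB)) (s : seq vec) : (1 < dA)%N ->
  \tr rho = 1 -> rho = \sum_(w <- s) proj w -> Et dA dB rho <= \sum_(w <- s) Eu w.
Proof. by move=> hA t1 es; rewrite -[leLHS]mul1r Et_le // scale1r. Qed.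

Lemma Et_set_neq0 rho : is_state rho -> Et_set rho !=set0.
Proof.
case=> /psd_ensemble[s es] t1; exists ((\sum_(w <- s) Eu w) / 1).
by apply: Et_set_ensemble => //; rewrite scale1r.
Qed.

Lemma Et_ge0 rho : (1 < dA)%N -> is_state rho -> 0 <= Et dA dB rho.
Proof.
move=> hA srho; apply: lb_le_inf; first exact: Et_set_neq0.
by move=> x; apply: Et_set_ge0.
Qed.

(** A near-optimal decomposition whose probabilities are absorbed into the vectors as square roots,
    [proj] and [Eu] both being quadratic. *)
Lemma Et_approx rho (e : R) : (1 < dA)%N -> is_state rho -> 0 < e ->
  exists2 s : seq vec, rho = \sum_(w <- s) proj w &
    \sum_(w <- s) Eu w < Et dA dB rho + e.
Proof.
move=> hA srho e0.
have [|x [n [p [v [[p0 _] uv er ->]]]] xe] := @inf_adherent R (Et_set rho) e e0.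
  by split; [exact: Et_set_neq0|exact: Et_set_lb].
exists [seq (Num.sqrt (p i))%:C *: v i | i <- enum 'I_n].
  by rewrite big_map big_enum /= er; apply: eq_bigr => i _; rewrite projZ sqr_sqrtr.
move: xe; rewrite big_map big_enum /=; congr (_ < _).
by apply: eq_bigr => i _; rewrite EuZ sqr_sqrtr // Et_pureE.
Qed.

Lemma Et_map (M rho : 'M[C]_(dA * dB)) : (1 < dA)%N -> is_state rho ->
  \tr (M *m rho *m M ^t*) = 1 -> (forall w, Eu (M *m w) <= Eu w) ->
  Et dA dB (M *m rho *m M ^t*) <= Et dA dB rho.
Proof.
move=> hA srho t1 hM; apply/ler_addgt0Pr => e e0.
have [s es /ltW se] := Et_approx hA srho e0; apply: le_trans se.
apply: le_trans (_ : \sum_(w <- [seq M *m w | w <- s]) Eu w <= _).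
  apply: Et_le1 => //; rewrite es mulmx_sumr mulmx_suml big_map.
  by apply: eq_bigr => w _; rewrite projM.
by rewrite big_map; apply: ler_sum.
Qed.

(** A local unitary is a pair of one-outcome measurements, one by each party. *)
Lemma Eu_unitary UA UB w : (1 < dA)%N -> UA \is unitarymx -> UB \is unitarymx ->
  Eu ((UA *t UB) *m w) <= Eu w.
Proof.
move=> hA uA uB; rewrite tensmx_decr -mulmxA.
have := Eu_instrA ((1%:M *t UB) *m w) hA (_ : \sum_(i < 1) UA ^t* *m UA = 1%:M).
rewrite !big_ord1 => /(_ (unitary_mul1 uA))/le_trans; apply.
have := Eu_instrB w hA (_ : \sum_(i < 1) UB ^t* *m UB = 1%:M).
by rewrite !big_ord1 => /(_ (unitary_mul1 uB)).
Qed.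

Lemma ct_tens m n p q (A : 'M[C]_(m, n)) (B : 'M[C]_(p, q)) :
  (A *t B) ^t* = A ^t* *t B ^t*.
Proof. by rewrite trmx_tens map_mxT. Qed.

Lemma tensmx1 m n : (1%:M : 'M[C]_m) *t (1%:M : 'M[C]_n) = 1%:M.
Proof.
apply/matrixP => i j; case: (mxtens_indexP i) => i1 i2; case: (mxtens_indexP j) => j1 j2.
rewrite tensmxE !mxE -natrM mulnb; congr ((_ : bool)%:R).
by rewrite (can_eq (@mxtens_indexK _ _)) xpair_eqE.
Qed.

Lemma tens_unitary (UA : 'M[C]_dA) (UB : 'M[C]_dB) :
  UA \is unitarymx -> UB \is unitarymx -> (UA *t UB) ^t* *m (UA *t UB) = 1%:M.
Proof. by move=> uA uB; rewrite ct_tens tensmx_mul !unitary_mul1 // tensmx1. Qed.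

Lemma Et_unitary UA UB rho : (1 < dA)%N -> UA \is unitarymx -> UB \is unitarymx ->
  is_state rho -> Et dA dB ((UA *t UB) *m rho *m (UA *t UB) ^t*) = Et dA dB rho.
Proof.
move=> hA uA uB srho; have [prho t1] := srho; set M := UA *t UB.
have MM : M ^t* *m M = 1%:M by apply: tens_unitary.
have tM : \tr (M *m rho *m M ^t*) = 1 by rewrite mxtrace_mulC mulmxA MM mul1mx.
have uM := Eu_unitary _ hA uA uB.
(* The reverse inequality is the same bound for the adjoint of M, again a product of local
   unitaries, which brings the state back to rho. *)
have e : rho = M ^t* *m (M *m rho *m M ^t*) *m M ^t* ^t*.
  by rewrite trmxCK !mulmxA MM mul1mx -mulmxA MM mulmx1.
apply/le_anti/andP; split; first exact: Et_map.
have sM : is_state (M *m rho *m M ^t*) by split => //; apply: psd_conj.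
have uM' w : Eu (M ^t* *m w) <= Eu w.
  by rewrite /M ct_tens; apply: Eu_unitary; rewrite ?trmxC_unitary.
have := Et_map hA sM _ uM'; rewrite -e; exact.
Qed.

Lemma Et_convex n (p : 'I_n -> R) (rhos : 'I_n -> 'M[C]_(dA * dB)) : (1 < dA)%N ->
  is_prob p -> (forall i, is_state (rhos i)) ->
  Et dA dB (\sum_(i < n) (p i)%:C *: rhos i) <= \sum_(i < n) p i * Et dA dB (rhos i).
Proof.
move=> hA [p0 p1] hr; apply/ler_addgt0Pr => e e0.
have /choice[s hs] i : exists s : seq vec, rhos i = \sum_(w <- s) proj w /\
    \sum_(w <- s) Eu w < Et dA dB (rhos i) + e.
  by have [s es se] := Et_approx hA (hr i) e0; exists s.
(* Near-optimal ensembles of the components, rescaled by the square roots of their weights and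
   concatenated, form an ensemble of the mixture. *)
pose S := flatten [seq [seq (Num.sqrt (p i))%:C *: w | w <- s i] | i <- enum 'I_n].
apply: le_trans (_ : \sum_(w <- S) Eu w <= _).
  apply: Et_le1 => //.
    rewrite raddf_sum /=; under eq_bigr do rewrite linearZ /= (hr _).2 mulr1.
    by rewrite -rmorph_sum p1.
  rewrite big_flatten big_map big_enum /=; apply: eq_bigr => i _.
  rewrite big_map (hs i).1 scaler_sumr; apply: eq_bigr => w _.
  by rewrite projZ sqr_sqrtr.
rewrite big_flatten big_map big_enum /=.
rewrite -[e]mul1r -p1 mulr_suml -big_split /=; apply: ler_sum => i _.
rewrite -mulrDr; apply: le_trans (ler_wpM2l (p0 i) (ltW (hs i).2)).
rewrite big_map mulr_sumr le_eqVlt; apply/orP; left; apply/eqP/eq_bigr => w _.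
by rewrite EuZ sqr_sqrtr.
Qed.

Lemma Et_locc m (t : locc R dA dB m) rho : (1 < dA)%N -> locc_valid t -> is_state rho ->
  \sum_(j < m | locc_prob t j rho != 0)
    locc_prob t j rho * Et dA dB (locc_state t j rho) <= Et dA dB rho.
Proof.
move=> hA vt srho; apply/ler_addgt0Pr => e e0.
have [s es /ltW se] := Et_approx hA srho e0; apply: le_trans se.
(* The Kraus operators labelled j carry the near-optimal ensemble of rho to an ensemble of the
   unnormalised outcome j. *)
have {es} oE j : locc_out t j rho =
    \sum_(w <- [seq q.2 *m w | q <- [seq q <- locc_kraus t | q.1 == j], w <- s]) proj w.
  rewrite big_allpairs_dep big_filter; apply: eq_bigr => q _.
  rewrite es mulmx_sumr mulmx_suml; apply: eq_bigr => w _.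
  by rewrite projM.
have pE j : \tr (locc_out t j rho) = (locc_prob t j rho)%:C.
  rewrite /locc_prob -ge0_Re // oE raddf_sum sumr_ge0 //= => w _.
  by rewrite trace_proj ler0c nrm2_ge0.
have p0 j : 0 <= locc_prob t j rho.
  by rewrite -ler0c -pE oE raddf_sum sumr_ge0 //= => w _; rewrite trace_proj ler0c nrm2_ge0.
have Ej j : locc_prob t j rho != 0 ->
   locc_prob t j rho * Et dA dB (locc_state t j rho) <=
   \sum_(q <- locc_kraus t | q.1 == j) \sum_(w <- s) Eu (q.2 *m w).
  move=> pn; have -> : \sum_(q <- locc_kraus t | q.1 == j) \sum_(w <- s) Eu (q.2 *m w) =
      \sum_(w <- [seq q.2 *m w | q <- [seq q <- locc_kraus t | q.1 == j], w <- s]) Eu w.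
    by rewrite big_allpairs_dep big_filter.
  have pp : (locc_prob t j rho)%:C != 0 by rewrite fmorph_eq0.
  apply: Et_le => //; first by rewrite lt_def pn p0.
    by rewrite /locc_state linearZ /= pE mulVf.
  by rewrite /locc_state scalerA divff // scale1r oE.
(* Outcomes of probability zero are put back with nonnegative terms. In the resulting sum each Kraus
   operator occurs once, under its own label, so [Eu_locc] applies to each vector of the
   ensemble. *)
apply: le_trans (_ : \sum_j \sum_(q <- locc_kraus t | q.1 == j) \sum_(w <- s) Eu (q.2 *m w) <= _).
  rewrite big_mkcond; apply: ler_sum => j _; case: ifP => [/Ej //|_].
  by do 2!(apply: sumr_ge0 => ? _); apply: Eu_ge0.
rewrite (exchange_big_dep xpredT) //=.
under eq_bigr => q _ do rewrite (big_pred1 q.1 (fun j => eq_sym _ _)).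
rewrite exchange_big; apply: ler_sum => w _; exact: Eu_locc.
Qed.

End Bipartite.

(** * Separable states, and shortening of ensembles *)

Section Separability.
Variables (R : realType) (dA dB : nat).
Local Notation C := R[i].
Local Notation D := (dA * dB)%N.
Local Notation vec := ('cV[C]_(dA * dB)).
Implicit Types rho : 'M[C]_(dA * dB).

Lemma proj_tens (a : 'cV[C]_dA) (b : 'cV[C]_dB) : proj (a *t b : vec) = proj a *t proj b.
Proof. by rewrite /proj -tensmx_mul; congr (_ *m _); exact: (@ct_tens R _ 1 _ 1 a b). Qed.

Lemma tens_suml (I : Type) (s : seq I) (F : I -> 'M[C]_dA) (b : 'M[C]_dB) :
  (\sum_(i <- s) F i) *t b = \sum_(i <- s) F i *t b.
Proof.
apply/matrixP => i j; rewrite summxE !mxE summxE mulr_suml.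
by apply: eq_bigr => k _; rewrite mxE.
Qed.

Lemma tens_sumr (I : Type) (s : seq I) (a : 'M[C]_dA) (F : I -> 'M[C]_dB) :
  a *t (\sum_(i <- s) F i) = \sum_(i <- s) a *t F i.
Proof.
apply/matrixP => i j; rewrite summxE !mxE summxE mulr_sumr.
by apply: eq_bigr => k _; rewrite mxE.
Qed.

Lemma tensZZ (c d : C) (a : 'M[C]_dA) (b : 'M[C]_dB) :
  (c *: a) *t (d *: b) = (c * d) *: (a *t b).
Proof. by apply/matrixP => i j; rewrite !mxE mulrACA. Qed.

Lemma separable_Et rho : (1 < dA)%N -> is_state rho -> separable dA dB rho ->
  Et dA dB rho = 0.
Proof.
move=> hA srho [n [p [a [b [[p0 p1] [sab er]]]]]].
have /choice[s hs] i : exists s : seq 'cV[C]_dA, a i = \sum_(w <- s) proj w.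
  by apply: psd_ensemble; case: (sab i) => -[].
have /choice[r hr] i : exists s : seq 'cV[C]_dB, b i = \sum_(w <- s) proj w.
  by apply: psd_ensemble; case: (sab i) => _ -[].
(* Decomposing each local factor into rank-one terms gives an ensemble of product vectors, on which
   [Eu] vanishes. *)
pose S := flatten [seq [seq (Num.sqrt (p i))%:C *: ((x : 'cV[C]_dA) *t (y : 'cV[C]_dB) : vec) | x <- s i, y <- r i] | i <- enum 'I_n].
apply/le_anti/andP; split; last exact: Et_ge0.
have -> : 0 = \sum_(w <- S) Eu w :> R.
  rewrite big_flatten big_map big_enum big1 // => i _.
  rewrite big_allpairs_dep big1 // => x _; rewrite big1 // => y _.
  by rewrite EuZ Eu_prod mulr0.
apply: Et_le1 => //; first by case: srho.
rewrite er big_flatten big_map big_enum; apply: eq_bigr => i _.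
rewrite (hs i) (hr i) tens_suml scaler_sumr big_allpairs_dep; apply: eq_bigr => x _.
rewrite tens_sumr scaler_sumr; apply: eq_bigr => y _.
by rewrite projZ sqr_sqrtr // proj_tens.
Qed.

(** With more vectors than functionals, the vectors of values satisfy a linear relation. Moving the
    weights along it until one of them reaches 0 preserves every sum and removes a vector;
    degree-two homogeneity realises a weight as a rescaling by its square root. *)
Lemma caratheodory (J : finType) (f : J -> vec -> R) (s : seq vec) :
  (forall j c w, f j (c%:C *: w) = c ^+ 2 * f j w) ->
  exists2 s' : seq vec, (size s' <= #|J|)%N &
    forall j, \sum_(w <- s') f j w = \sum_(w <- s) f j w.
Proof.
move=> fZ; have [n] := ubnP (size s); elim: n s => // n IH s /ltnSE ns.
have [sJ|Js] := leqP (size s) #|J|; first by exists s.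
pose A := \matrix_(i < size s, j < #|J|) f (enum_val j) s`_i.
have : kermx A != 0.
  rewrite kermx_eq0 /row_free; apply/eqP => rA.
  by have := rank_leq_col A; rewrite rA leqNgt Js.
case/rowV0Pn => k0 /sub_kermxP k0A k0n.
(* The sign of the relation is chosen so that some coefficient is positive. *)
have [k [kA [i1 ki1]]] : exists k : 'rV[R]_(size s), k *m A = 0 /\ exists i, 0 < k 0 i.
  have /rV0Pn[i ki] := k0n; have [k0i|k0i] := ltP 0 (k0 0 i).
    by exists k0; split => //; exists i.
  exists (- k0); split; first by rewrite mulNmx k0A oppr0.
  by exists i; rewrite mxE oppr_gt0 lt_def eq_sym ki.
pose i0 := [arg max_(i > i1) k 0 i]%O.
have kmax i : k 0 i <= k 0 i0 by rewrite /i0; case: arg_maxP => // j _; apply.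
have ki0 : 0 < k 0 i0 by apply: lt_le_trans (kmax i1).
(* Dividing by the largest coefficient, which is positive, keeps all new weights nonnegative and
   makes the one at [i0] vanish. *)
pose g i := 1 - k 0 i / k 0 i0.
have g0 i : 0 <= g i by rewrite subr_ge0 ler_pdivrMr // mul1r.
have gi0 : g i0 = 0 by rewrite /g divff ?gt_eqF // subrr.
pose s' := [seq (Num.sqrt (g i))%:C *: s`_i | i : 'I_(size s) <- [seq i <- enum 'I_(size s) | i != i0]].
have s's : (size s' < size s)%N.
  rewrite size_map size_filter -[X in (_ < X)%N](size_enum_ord (size s)) -(count_predC (fun i => i != i0)).
  rewrite -[ltnLHS]addn0 ltn_add2l -has_count; apply/hasP; exists i0.
    by rewrite mem_enum.
  by rewrite /= negbK.
have [|s2 s2J es2] := IH s'; first exact: leq_trans ns.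
exists s2 => // j; rewrite es2 big_map big_filter big_enum_cond /=.
have e : \sum_(i | i != i0) f j ((Num.sqrt (g i))%:C *: s`_i) = \sum_i g i * f j s`_i.
  rewrite [RHS](bigD1 i0) //= gi0 mul0r add0r.
  by apply: eq_bigr => i _; rewrite fZ sqr_sqrtr.
rewrite e [RHS](big_nth 0) big_mkord.
under eq_bigr do rewrite /g mulrBl mul1r.
rewrite sumrB -[RHS]subr0; congr (_ - _).
have /matrixP/(_ 0 (enum_rank j)) := kA; rewrite !mxE => kj.
rewrite -[RHS](mulr0 (k 0 i0)^-1) -[X in _ = _ * X]kj mulr_sumr; apply: eq_bigr => i _.
by rewrite !mxE enum_rankK mulrA [_ / _]mulrC.
Qed.

(** * Second-order minors and product vectors *)

Definition sqn (z : C) : R := complex.Re z ^+ 2 + complex.Im z ^+ 2.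

Lemma sqn_ge0 z : 0 <= sqn z.
Proof. by rewrite addr_ge0 ?sqr_ge0. Qed.

Lemma sqn_eq0 z : sqn z = 0 -> z = 0.
Proof.
case: z => a b /eqP; rewrite /sqn /= paddr_eq0 ?sqr_ge0 // !sqrf_eq0.
by case/andP => /eqP -> /eqP ->.
Qed.

Lemma sqnE z : (sqn z)%:C = z * Num.conj z.
Proof. by rewrite /sqn add_Re2_Im2 normCK. Qed.

Definition minor (w : vec) i i' j j' : C :=
  Wmx w i j * Wmx w i' j' - Wmx w i j' * Wmx w i' j.

Definition minors2 (w : vec) : R :=
  \sum_i \sum_i' \sum_j \sum_j' sqn (minor w i i' j j').

(** A Cauchy-Binet identity. The factor 2 arises because [minors2] runs over all index quadruples
    and so counts each minor four times, while the trace expression is twice the second elementary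
    symmetric function of the eigenvalues. *)
Lemma minors2E w : let G := Wmx w *m (Wmx w) ^t* in
  (minors2 w)%:C = 2 * ((\tr G) ^+ 2 - \tr (G *m G)).
Proof.
move=> G; have -> : (\tr G) ^+ 2 = \sum_i \sum_i' G i i * G i' i'.
  by rewrite expr2 mulr_suml; apply: eq_bigr => i _; rewrite mulr_sumr.
have -> : \tr (G *m G) = \sum_i \sum_i' G i i' * G i' i.
  by apply: eq_bigr => i _; rewrite mxE.
rewrite -sumrB mulr_sumr rmorph_sum; apply: eq_bigr => i _.
rewrite -sumrB mulr_sumr rmorph_sum; apply: eq_bigr => i' _.
have GE a b c d : G a b * G c d = \sum_j \sum_j'
    (Wmx w a j * Num.conj (Wmx w b j)) * (Wmx w c j' * Num.conj (Wmx w d j')).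
  rewrite /G !mxE mulr_suml; apply: eq_bigr => j _; rewrite mulr_sumr.
  by apply: eq_bigr => j' _; rewrite !mxE.
(* Writing each product in both orders yields the four terms of the expanded squared modulus of a
   minor, which then match index by index. *)
have -> : 2 * (G i i * G i' i' - G i i' * G i' i) =
   G i i * G i' i' + G i' i' * G i i - G i i' * G i' i - G i' i * G i i' by ring.
rewrite !GE rmorph_sum -big_split -!sumrB /=; apply: eq_bigr => j _.
rewrite rmorph_sum -big_split -!sumrB /=; apply: eq_bigr => j' _.
by rewrite sqnE /minor rmorphB !rmorphM /=; ring.
Qed.

(** [Sh_quad] for W W^*; the constant collects the 2 of [minors2E], the ln 2 of the entropy bound
    and the normalisation of [Eu]. *)
Lemma minors2_le w : (1 < dA)%N -> nrm2 w <= 1 ->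
  minors2 w <= 2 * ln 2 * rnorm R dA * Eu w.
Proof.
move=> hA w1; have := @Sh_quad R _ _ (psd_gram (Wmx w)).
rewrite trace_Wmx => /(_ w1); rewrite -trace_Wmx => h.
have r0 := rnorm_gt0 R hA.
have -> : 2 * ln 2 * rnorm R dA * Eu w = 2 * (ln 2 * Sh (Wmx w *m (Wmx w) ^t*)).
  by rewrite /Eu; field; rewrite gt_eqF.
have := congr1 (@complex.Re R) (minors2E w).
move: h; set Z := _ ^+ 2 - _ => h; rewrite mulr_natl mulr2n.
have -> : complex.Re (Z + Z) = complex.Re Z + complex.Re Z by case: (Z).
move=> /= ->; lra.
Qed.

Lemma minors2_eq0 w : minors2 w = 0 -> forall i i' j j', minor w i i' j j' = 0.
Proof.
move=> h i i' j j'; apply: sqn_eq0.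
have z (n : nat) (F : 'I_n -> R) : (forall k, 0 <= F k) -> \sum_k F k = 0 -> forall k, F k = 0.
  by move=> F0 /eqP; rewrite psumr_eq0 // => /allP FA k; apply/eqP/(FA k)/mem_index_enum.
have s0 (n : nat) (F : 'I_n -> R) : (forall k, 0 <= F k) -> 0 <= \sum_k F k by move=> ?; apply: sumr_ge0.
have h1 := z _ _ (fun=> s0 _ _ (fun=> s0 _ _ (fun=> s0 _ _ (fun=> sqn_ge0 _)))) h i.
have h2 := z _ _ (fun=> s0 _ _ (fun=> s0 _ _ (fun=> sqn_ge0 _))) h1 i'.
have h3 := z _ _ (fun=> s0 _ _ (fun=> sqn_ge0 _)) h2 j.
exact: z _ _ (fun=> sqn_ge0 _) h3 j'.
Qed.

Lemma proj_state n (v : 'cV[C]_n) : nrm2 v = 1 -> is_state (proj v).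
Proof. by move=> v1; split; [exact: psd_gram | rewrite trace_proj v1]. Qed.

Lemma proj_eq_scaled_state n (v : 'cV[C]_n) : (0 < n)%N ->
  exists2 A : 'M[C]_n, is_state A & proj v = (nrm2 v)%:C *: A.
Proof.
move=> n0; have [v0|vn] := eqVneq (nrm2 v) 0.
  have -> : v = 0 by apply: nrm2_eq0.
  (* The zero vector carries weight zero, so any state will do; a basis vector is available as n >
     0. *)
  exists (proj (delta_mx (Ordinal n0) 0)).
    apply: proj_state; rewrite /nrm2 trmx_delta map_delta_mx mul_delta_mx mxE.
    by rewrite !eqxx.
  by rewrite /nrm2 mulmx0 mxE scale0r /proj mul0mx.
have vp : 0 < nrm2 v by rewrite lt_def vn nrm2_ge0.
have c2 : (Num.sqrt (nrm2 v))^-1 ^+ 2 = (nrm2 v)^-1 by rewrite exprVn sqr_sqrtr // ltW.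
exists (proj ((Num.sqrt (nrm2 v))^-1%:C *: v)).
  by apply: proj_state; rewrite nrm2Z c2 mulVf.
by rewrite projZ c2 scalerA -rmorphM divff // rmorph1 scale1r.
Qed.

Lemma rank1_product w : minors2 w = 0 ->
  exists (a : 'cV[C]_dA) (b : 'cV[C]_dB), w = a *t b.
Proof.
move=> /minors2_eq0 w0.
have [/eqP Wz|] := boolP (Wmx w == 0).
  exists 0, 0; rewrite tens0mx; apply/matrixP => k l; rewrite [l]ord1 mxE.
  case: (mxtens_indexP k) => i j.
  by move/matrixP: Wz => /(_ i j); rewrite !mxE.
case/matrix0Pn => i0 [j0 Wn].
(* The column and the row through a nonzero pivot, the row divided by the pivot; the minors
   containing the pivot give the factorisation. *)
exists (\col_i Wmx w i j0), (\col_j (Wmx w i0 j / Wmx w i0 j0)).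
apply/matrixP => k l; rewrite [l]ord1; case: (mxtens_indexP k) => i j.
have -> : w (mxtens_index (i, j)) 0 = Wmx w i j by rewrite mxE.
rewrite [RHS]mxE mxtens_indexK /= ![(\col__ _) _ _]mxE mulrA.
have /eqP := w0 i i0 j j0; rewrite /minor subr_eq0 => /eqP.
by move=> <-; rewrite mulfK.
Qed.

Lemma nrm2_tens (a : 'cV[C]_dA) (b : 'cV[C]_dB) : nrm2 (a *t b : vec) = nrm2 a * nrm2 b.
Proof.
apply: (@complexI R); rewrite rmorphM /= -!trace_proj proj_tens.
rewrite /mxtrace sum_mxtens mulr_suml; apply: eq_bigr => i _.
by rewrite mulr_sumr; apply: eq_bigr => j _; rewrite tensmxE.
Qed.

Lemma minors0_product w : (0 < dA)%N -> (0 < dB)%N -> minors2 w = 0 ->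
  exists ab : 'M[C]_dA * 'M[C]_dB, [/\ is_state ab.1, is_state ab.2 &
    proj w = (nrm2 w)%:C *: (ab.1 *t ab.2)].
Proof.
move=> hA hB /rank1_product[a [b ->]].
have [A sA eA] := proj_eq_scaled_state a hA; have [B sB eB] := proj_eq_scaled_state b hB.
exists (A, B); split => //=.
by rewrite proj_tens nrm2_tens eA eB tensZZ -rmorphM.
Qed.

Lemma nrm2_sum n (w : 'cV[C]_n) : nrm2 w = \sum_i sqn (w i 0).
Proof.
apply: (@complexI R); rewrite -nrm2E mxE rmorph_sum /=; apply: eq_bigr => i _.
by rewrite !mxE sqnE mulrC.
Qed.

(** Places the real coordinates of such vectors in the compact box [-1, 1]^N used for the
    minimisation. *)
Lemma sqn_entry_le n (w : 'cV[C]_n) i : nrm2 w <= 1 ->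
  (-1 <= complex.Re (w i 0) <= 1) && (-1 <= complex.Im (w i 0) <= 1).
Proof.
rewrite nrm2_sum (bigD1 i) //= => h.
have : 0 <= \sum_(j < n | j != i) sqn (w j 0) by apply: sumr_ge0 => j _; apply: sqn_ge0.
move: h; rewrite /sqn; set x := complex.Re _; set y := complex.Im _; set S := \sum_(_ < _ | _) _.
by move=> h1 h2; apply/andP; split; apply/andP; split; nra.
Qed.

(** * Continuity of complex-valued functions through real and imaginary parts *)

Section ComplexContinuity.
Variable T : topologicalType.

Definition ccont (f : T -> C) : Prop :=
  continuous (fun x => complex.Re (f x) : R) /\ continuous (fun x => complex.Im (f x) : R).

Lemma ccont_cst c : ccont (fun=> c).
Proof. by split => x; apply: cvg_cst. Qed.

Lemma ccontD f g : ccont f -> ccont g -> ccont (fun x => f x + g x).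
Proof.
move=> [f1 f2] [g1 g2]; split => x.
  rewrite (_ : (fun _ => _) = (fun y => complex.Re (f y) + complex.Re (g y))).
    by apply: cvgD; [exact: f1|exact: g1].
  by apply/funext => y; case: (f y) (g y) => a b [c d].
rewrite (_ : (fun _ => _) = (fun y => complex.Im (f y) + complex.Im (g y))).
  by apply: cvgD; [exact: f2|exact: g2].
by apply/funext => y; case: (f y) (g y) => a b [c d].
Qed.

Lemma ccontN f : ccont f -> ccont (fun x => - f x).
Proof.
move=> [f1 f2]; split => x.
  rewrite (_ : (fun _ => _) = (fun y => - complex.Re (f y))).
    by apply: cvgN; exact: f1.
  by apply/funext => y; case: (f y).
rewrite (_ : (fun _ => _) = (fun y => - complex.Im (f y))).
  by apply: cvgN; exact: f2.
by apply/funext => y; case: (f y).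
Qed.

Lemma ccont_conj f : ccont f -> ccont (fun x => Num.conj (f x)).
Proof.
move=> [f1 f2]; split => x.
  rewrite (_ : (fun _ => _) = (fun y => complex.Re (f y))).
    exact: f1.
  by apply/funext => y; case: (f y).
rewrite (_ : (fun _ => _) = (fun y => - complex.Im (f y))).
  by apply: cvgN; exact: f2.
by apply/funext => y; case: (f y).
Qed.

Lemma ccontM f g : ccont f -> ccont g -> ccont (fun x => f x * g x).
Proof.
move=> [f1 f2] [g1 g2]; split => x.
  rewrite (_ : (fun _ => _) = (fun y => complex.Re (f y) * complex.Re (g y) - complex.Im (f y) * complex.Im (g y))).
    by apply: cvgB; apply: cvgM; [exact: f1|exact: g1|exact: f2|exact: g2].
  by apply/funext => y; case: (f y) (g y) => a b [c d].
rewrite (_ : (fun _ => _) = (fun y => complex.Re (f y) * complex.Im (g y) + complex.Im (f y) * complex.Re (g y))).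
  by apply: cvgD; apply: cvgM; [exact: f1|exact: g2|exact: f2|exact: g1].
by apply/funext => y; case: (f y) (g y) => a b [c d].
Qed.

Lemma continuous_sum (J : finType) (f : J -> T -> R) :
  (forall i, continuous (f i)) -> continuous (fun x => \sum_i f i x : R).
Proof. by move=> fc; apply: continuous_big => //; apply: add_continuous. Qed.

Lemma ccont_sum (J : finType) (f : J -> T -> C) :
  (forall i, ccont (f i)) -> ccont (fun x => \sum_i f i x).
Proof.
move=> fc; split.
  rewrite (_ : (fun _ => _) = (fun y => \sum_i complex.Re (f i y))).
    by apply: continuous_sum => i; case: (fc i).
  by apply/funext => y; rewrite Re_sum.
rewrite (_ : (fun _ => _) = (fun y => \sum_i complex.Im (f i y))).
  by apply: continuous_sum => i; case: (fc i).
by apply/funext => y; rewrite Im_sum.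
Qed.

Lemma sqn_continuous f : ccont f -> continuous (fun x => sqn (f x)).
Proof.
by move=> [f1 f2] x; apply: cvgD; rewrite /GRing.exp /=; apply: cvgM; [exact: f1|exact: f1|exact: f2|exact: f2].
Qed.

End ComplexContinuity.

(** * Compactness for ensembles of bounded size *)

Section Compactness.
Variable M : nat.
Let I : finType := ('I_M * 'I_D * bool)%type.
Local Notation par := ('rV[R]_#|I|).

(** All M vectors are read off one flat real row vector, the boolean selecting the imaginary part,
    so that compactness of a real box can be used. *)
Definition pvec (x : par) (k : 'I_M) : vec :=
  \col_j (x 0 (enum_rank (k, j, false)) +i* x 0 (enum_rank (k, j, true))).

Lemma ccont_pvec k j : ccont (fun x => pvec x k j 0).
Proof.
split.
  rewrite (_ : (fun _ => _) = (fun y : par => y 0 (enum_rank (k, j, false)))).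
    exact: coord_continuous.
  by apply/funext => y; rewrite mxE.
rewrite (_ : (fun _ => _) = (fun y : par => y 0 (enum_rank (k, j, true)))).
  exact: coord_continuous.
by apply/funext => y; rewrite mxE.
Qed.

Definition residual rho (x : par) : 'M[C]_(dA * dB) := rho - \sum_k proj (pvec x k).

(* Vanishes exactly when the [pvec x k] form an ensemble of product vectors
   for [rho]. *)
Definition defect rho (x : par) : R :=
  \sum_k minors2 (pvec x k) + \sum_a \sum_b sqn (residual rho x a b).

Lemma ccont_Wmx k i j : ccont (fun x => Wmx (pvec x k) i j).
Proof.
rewrite (_ : (fun _ => _) = (fun x => pvec x k (mxtens_index (i, j)) 0)).
  exact: ccont_pvec.
by apply/funext => y; rewrite mxE.
Qed.

Lemma ccont_residual rho a b : ccont (fun x => residual rho x a b).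
Proof.
rewrite (_ : (fun _ => _) = (fun x => rho a b + - \sum_k pvec x k a 0 * Num.conj (pvec x k b 0))).
  apply: ccontD; first exact: ccont_cst.
  apply: ccontN; apply: ccont_sum => k; apply: ccontM; first exact: ccont_pvec.
  exact/ccont_conj/ccont_pvec.
apply/funext => x; rewrite /residual !mxE summxE; congr (_ - _).
by apply: eq_bigr => k _; rewrite mxE big_ord1 !mxE.
Qed.

Lemma defect_continuous rho : continuous (defect rho).
Proof.
have c1 : continuous (fun x => \sum_k minors2 (pvec x k) : R).
  do 5!(apply: continuous_sum => ?); apply: sqn_continuous.
  by apply: ccontD; [|apply: ccontN]; apply: ccontM; apply: ccont_Wmx.
have c2 : continuous (fun x => \sum_a \sum_b sqn (residual rho x a b) : R).
  by do 2!(apply: continuous_sum => ?); apply/sqn_continuous/ccont_residual.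
by move=> x; apply: continuousD; [exact: c1|exact: c2].
Qed.

Lemma minors2_ge0 w : 0 <= minors2 w.
Proof. by do 4!(apply: sumr_ge0 => ? _); apply: sqn_ge0. Qed.

Lemma defect_eq0 rho x : defect rho x <= 0 ->
  (forall k, minors2 (pvec x k) = 0) /\ rho = \sum_k proj (pvec x k).
Proof.
have m0 : 0 <= \sum_k minors2 (pvec x k) by apply: sumr_ge0 => k _; apply: minors2_ge0.
have r0 : 0 <= \sum_a \sum_b sqn (residual rho x a b).
  by do 2!(apply: sumr_ge0 => ? _); apply: sqn_ge0.
rewrite /defect => d0.
have /eqP : \sum_k minors2 (pvec x k) = 0 by lra.
rewrite psumr_eq0 => [/allP mz|k _]; last exact: minors2_ge0.
have /eqP : \sum_a \sum_b sqn (residual rho x a b) = 0 by lra.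
rewrite psumr_eq0 => [/allP rz|a _]; last by apply: sumr_ge0 => ? _; apply: sqn_ge0.
split=> [k|]; first exact/eqP/mz/mem_index_enum.
apply/eqP; rewrite -subr_eq0; apply/eqP/matrixP => a b; rewrite [RHS]mxE; apply: sqn_eq0.
have := rz a (mem_index_enum _).
by rewrite /= psumr_eq0 => [/allP/(_ b (mem_index_enum _))/eqP|? _]; last exact: sqn_ge0.
Qed.

(** The continuous [defect] attains its minimum on the box. The hypothesis supplies points of the
    box with defect at most e for every e > 0, so the minimum is at most 0 and the minimiser is the
    required ensemble. *)
Lemma defect_min rho :
  (forall e, 0 < e -> exists w : 'I_M -> vec,
    [/\ forall k, nrm2 (w k) <= 1, rho = \sum_k proj (w k) &
        \sum_k minors2 (w k) <= e]) ->
  exists w : 'I_M -> vec, (forall k, minors2 (w k) = 0) /\ rho = \sum_k proj (w k).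
Proof.
move=> h; pose B : set par := [set x | forall i, `[-1, 1]%classic (x ord0 i)]%classic.
have cB : compact B.
  by apply: (@rV_compact R _ (fun=> `[-1, 1]%classic)) => i; apply: segment_compact.
have B0 : (B !=set0)%classic by exists 0 => i /=; rewrite mxE in_itv /=; lra.
have [x _ xmin] := compact_EVT_min B0 cB (continuous_subspaceT (@defect_continuous rho)).
exists (pvec x); apply: defect_eq0.
apply/ler_addgt0Pr => e /h[w [w1 er we]]; rewrite add0r; apply: le_trans we.
pose y : par := \row_l let: (k, j, b) := enum_val l in
  if b then complex.Im (w k j 0) else complex.Re (w k j 0).
have yw k : pvec y k = w k.
  apply/matrixP => j j'; rewrite [j']ord1 !mxE !enum_rankK.
  by case: (w k j 0).
have yB : y \in B.
  rewrite inE => l /=; rewrite mxE in_itv /=; case: (enum_val l) => -[k j] b.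
  by have := sqn_entry_le j (w1 k); case: b => /andP[].
apply: le_trans (xmin y yB) _; rewrite /defect /residual.
under eq_bigr do rewrite yw.
rewrite [X in _ + X]big1 ?addr0 // => a _; rewrite big1 // => b _.
under eq_bigr do rewrite yw.
by rewrite -er subrr mxE /sqn expr0n addr0.
Qed.

End Compactness.

Lemma Et0_separable rho : (1 < dA)%N -> (0 < dB)%N -> is_state rho ->
  Et dA dB rho = 0 -> separable dA dB rho.
Proof.
move=> hA hB srho E0; have [_ t1] := srho; have hA0 := ltnW hA.
(* The quantities to be preserved when shortening: [Eu] and the real and imaginary parts of all
   entries of [proj w]. Their number bounds the ensemble size independently of e, as compactness
   requires. *)
pose J : finType := option (bool * ('I_D * 'I_D)).
pose f (j : J) (w : vec) : R := match j with
  | None => Eu w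
  | Some (b, (k, l)) => if b then complex.Im (proj w k l) else complex.Re (proj w k l) end.
have fZ j c w : f j (c%:C *: w) = c ^+ 2 * f j w.
  case: j => [[b [k l]]|] /=; last exact: EuZ.
  by rewrite projZ mxE; case: (proj w k l) => x y; case: b => /=; rewrite ?mul0r ?addr0 ?subr0.
have [|w [w0 er]] := @defect_min #|J| rho.
  move=> e e0; pose c := 2 * ln 2 * rnorm R dA.
  have c0 : 0 < c by rewrite !mulr_gt0 ?ln2_gt0 ?rnorm_gt0.
  have [s es] := Et_approx hA srho (divr_gt0 e0 c0); rewrite E0 add0r => se.
  have [s' s'J fs] := caratheodory s fZ.
  (* Shorter ensembles are padded to size #|J| by the default value 0 of the list access. *)
  have sE (V : nmodType) (F : vec -> V) : F 0 = 0 ->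
      \sum_(k < #|J|) F s'`_k = \sum_(w <- s') F w.
    move=> F0; rewrite [RHS](big_nth 0) big_mkord (big_ord_widen _ (fun k => F s'`_k) s'J).
    rewrite [RHS]big_mkcond; apply: eq_bigr => k _; case: ltnP => // ks.
    by rewrite nth_default.
  have proj0 : proj (0 : vec) = 0 by rewrite /proj mul0mx.
  have er : rho = \sum_(k < #|J|) proj s'`_k.
    rewrite (sE _ (@proj R _)) // es; apply/matrixP => k l; rewrite !summxE.
    have := fs (Some (true, (k, l))); have := fs (Some (false, (k, l))).
    rewrite /f -!Re_sum -!Im_sum.
    by case: (\sum_(w <- s') _) (\sum_(w <- s) _) => a b [a' b'] /= -> ->.
  (* The squared norms add up to the trace of rho, which is 1; this is the normalisation that
     [minors2_le] needs. *)
  have n1 k : nrm2 s'`_k <= 1.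
    have [ks|ks] := ltnP k #|J|; last first.
      by rewrite nth_default ?(leq_trans s'J) // /nrm2 mulmx0 mxE ler01.
    have /(congr1 mxtrace) := er; rewrite t1 raddf_sum /=.
    under eq_bigr do rewrite trace_proj.
    rewrite -rmorph_sum => /complexI ->; rewrite (bigD1 (Ordinal ks)) //= lerDl.
    by apply: sumr_ge0 => ? _; apply: nrm2_ge0.
  exists (fun k : 'I_#|J| => s'`_k); split => //.
  apply: (@le_trans _ _ (\sum_(k < #|J|) c * Eu s'`_k)).
    by apply: ler_sum => k _; apply: minors2_le.
  rewrite -mulr_sumr (sE _ (@Eu R dA dB)) ?Eu0 // mulrC -ler_pdivlMr //.
  by rewrite (fs None) ltW.
(* Each limit vector is a product vector, hence a multiple of a product state; its squared norm
   serves as the probability. *)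
have /choice[ab hab] k := minors0_product hA0 hB (w0 k).
exists #|J|, (fun k => nrm2 (w k)), (fun k => (ab k).1), (fun k => (ab k).2); split.
  split=> [k|]; first exact: nrm2_ge0.
  apply: (@complexI R); rewrite rmorph_sum -[RHS]t1 er raddf_sum /=.
  by apply: eq_bigr => k _; rewrite trace_proj.
split=> [k|]; first by case: (hab k).
by rewrite er; apply: eq_bigr => k _; case: (hab k).
Qed.

End Separability.

Theorem theorem1 (R : realType) (dA dB : nat) (hA : (1 < dA)%N) (hB : (0 < dB)%N) :
  (* (E1) non-negativity, and vanishing exactly on separable states *)
  (forall rho : 'M[R[i]]_(dA * dB), is_state rho ->
     0 <= Et dA dB rho /\ (Et dA dB rho = 0 <-> separable dA dB rho)) /\
  (* (E2) invariance under local unitaries *)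
  (forall (UA : 'M[R[i]]_dA) (UB : 'M[R[i]]_dB) (rho : 'M[R[i]]_(dA * dB)),
     UA \is unitarymx -> UB \is unitarymx -> is_state rho ->
     Et dA dB ((UA *t UB) *m rho *m (UA *t UB) ^t*) = Et dA dB rho) /\
  (* (E3) non-increase on average under LOCC *)
  (forall (m : nat) (t : locc R dA dB m) (rho : 'M[R[i]]_(dA * dB)),
     locc_valid t -> is_state rho ->
     \sum_(j < m | locc_prob t j rho != 0)
        locc_prob t j rho * Et dA dB (locc_state t j rho) <= Et dA dB rho) /\
  (* (E4) convexity *)
  (forall (n : nat) (p : 'I_n -> R) (rhos : 'I_n -> 'M[R[i]]_(dA * dB)),
     is_prob p -> (forall i, is_state (rhos i)) ->
     Et dA dB (\sum_(i < n) (p i)%:C *: rhos i) <= \sum_(i < n) p i * Et dA dB (rhos i)).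
Proof.
split; [|split; [|split]].
- move=> rho srho; split; first exact: Et_ge0.
  split; first exact: Et0_separable.
  exact: separable_Et.
- by move=> UA UB rho uA uB srho; apply: Et_unitary.
- by move=> m t rho vt srho; apply: Et_locc.
- by move=> n p rhos hp hr; apply: Et_convex.
Qed.
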